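(* For every $n\ge 2$, the skein relation $\langle 12\ldots n\rangle$ has width exactly $$w(\langle 12\ldots n\rangle)=\left\lfloor \frac{n^2}{2}\right\rfloor .$$
   Context: An $n$-crossing is a point of a link projection at which $n$ strands cross, each bisecting the crossing; locally it consists of $n$ distinct diameters of a disk, joining antipodal pairs among $2n$ equally spaced boundary points, at pairwise distinct heights. An $n$-split is a crossingless perfect matching of the $2n$ boundary points by $n$ disjoint arcs in the disk (up to isotopy). A-splits and B-splits: at a double crossing, the two regions swept out by rotating the overstrand counterclockwise until it meets the understrand are the A-regions; the A-split joins the two A-regions and has coefficient $A$; the B-split joins the other two regions and has coefficient $A^{-1}$. The $n$-skein relation of an $n$-crossing is the formal sum of $n$-splits with coefficients in $\mathbb Z[A^{\pm1}]$ defined recursively: a single strand ($n=1$) has the relation consisting of one arc with coefficient $A^0$. If $x'$ is an $(n+1)$-crossing, let $O$ be its top strand and $x$ the $n$-crossing obtained by deleting $O$. For each term in the $n$-skein relation of $x$, lay $O$ as an overstrand over its split (as a diameter meeting exactly the arcs whose endpoints it separates, each once), and resolve the resulting double crossings in all possible combinations of A-splits and B-splits, multiplying the coefficient by $A$ for each A-split and by $A^{-1}$ for each B-split. The sum of everything so obtained is the $(n+1)$-skein relation of $x'$. A term of the relation is a split together with a coefficient $JA^t$ ($J,t$ integers, $J\neq 0$); its power is $t$. The width $w(R)$ of a skein relation $R$ is the difference between the highest and the lowest power appearing in it. $\langle 12\ldots n\rangle$ denotes the $n$-skein relation of the $n$-crossing in which, for $2\le k\le n$, the $k$-th highest strand is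 immediately clockwise of the $(k-1)$-st highest strand. *)

(* Defs.v *)
From HB Require Import structures.
From mathcomp Require Import all_boot all_order all_fingroup all_algebra.
From mathcomp Require Import finmap.
From mathcomp.multinomials Require Import monalg.

Set Implicit Arguments.
Unset Strict Implicit.
Unset Printing Implicit Defensive.

Import Order.TTheory GRing.Theory Num.Theory.

Local Open Scope ring_scope.

(* The 2n boundary points of the disk are numbered clockwise by 'I_(n + n);
   strand d : 'I_n is the diameter joining the points d and n + d, so strand
   d.+1 is immediately clockwise of strand d.  Deleting a strand leaves its two
   boundary points unused instead of renumbering the others: only the cyclic
   order of the remaining points matters. *)
Section SkeinRelation.
Variable n : nat.

Notation point := 'I_(n + n).
Notation strand := 'I_n.

(* An arc is the set of its two endpoints; up to isotopy, a split is determined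
   by the set of its arcs.  (Starting from a single diameter, the resolutions
   below only ever produce crossingless perfect matchings of the endpoints of
   the strands considered.) *)
Notation split := {set {set point}}.

Definition tail (d : strand) : point := lshift n d.
Definition tip (d : strand) : point := rshift n d.

(* Strand d is travelled from its tail to its tip.  The boundary points met when
   going clockwise from the tail to the tip lie on its left. *)
Definition left_points (d : strand) : seq point :=
  [seq p : point <- enum point | (d < p < n + d)%N].
Definition right_points (d : strand) : seq point :=
  [seq p : point <- enum point | (p < d)%N || (n + d < p)%N].

(* The arcs of S separated by strand d, as pairs (left end, right end), listed in
   the order of the left ends: as S is crossingless, this is the order in which d
   meets them. *)
Definition crossed (S : split) (d : strand) : seq (point * point) :=
  [seq c <- [seq (l, r) | l <- left_points d, r <- right_points d]
         | [set c.1; c.2] \in S].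

(* Resolution of the crossings met along the overstrand, [true] standing for an
   A-split.  The boundary point e is the other end of the arc being followed
   when the next crossing, with the arc (l, r), is reached.  Rotating the
   overstrand counterclockwise sweeps the front left and the back right regions.
   Joining them connects the incoming half of the overstrand to l and its
   outgoing half to r; the B-split exchanges l and r. *)
Fixpoint resolved_arcs (e stop : point) (cs : seq (point * point))
    (state : seq bool) : split :=
  match cs, state with
  | (l, r) :: cs', true :: state' =>
      [set e; l] |: resolved_arcs r stop cs' state'
  | (l, r) :: cs', false :: state' =>
      [set e; r] |: resolved_arcs l stop cs' state'
  | _, _ => [set [set e; stop]]
  end.

Definition resolve (S : split) (d : strand) (state : seq bool) : split :=
  let cs := crossed S d in
  (S :\: [set [set c.1; c.2] | c in cs])
    :|: resolved_arcs (tail d) (tip d) cs state.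

Definition state_power (state : seq bool) : int :=
  \sum_(a <- state) (if a then 1 else -1).

(* A formal sum of splits over Z[A, A^-1], seen as a finitely supported function
   mapping (S, t) to the integer coefficient of A^t in the coefficient of S. *)
Definition relation := {malg int[(split * int)%type]}.

Definition lay_over (d : strand) (R : relation) : relation :=
  \sum_(T <- msupp R)
    \sum_(state : (size (crossed T.1 d)).-tuple bool)
      << R@_T *g (resolve T.1 d state, T.2 + state_power state) >>.

(* The strands are listed from top to bottom. *)
Fixpoint skein (s : seq strand) : relation :=
  match s with
  | [::] => 0
  | [:: d] => << 1 *g ([set [set tail d; tip d]], 0) >>
  | d :: s' => lay_over d (skein s')
  end.

(* An n-crossing is given by the permutation x for which x k is the strand with
   exactly k strands above it. *)
Definition skein_relation (x : 'S_n) : relation :=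
  skein [seq x k | k <- enum 'I_n].

(* The highest strand is numbered 0, so that the strands are numbered by
   decreasing height as one turns clockwise. *)
Definition skein_12n : relation := skein_relation 1%g.

Definition powers (R : relation) : seq int := [seq T.2 | T <- msupp R].

(* The highest and lowest powers are meaningful when R is not 0; the default
   value [head 0 (powers R)] is then itself one of the powers. *)
Definition max_power (R : relation) : int :=
  \big[Num.max/head 0 (powers R)]_(t <- powers R) t.
Definition min_power (R : relation) : int :=
  \big[Num.min/head 0 (powers R)]_(t <- powers R) t.

Definition width (R : relation) : int := max_power R - min_power R.

End SkeinRelation.

(* Main.v *)
(* No cancellation occurs between the terms, so the width is the spread of the
   powers over all choices of resolutions.  If the overstrand meets j arcs and is
   resolved with a A-splits, the power changes by 2a - j, and the number j' of
   arcs met by the next overstrand is j + 1 minus the number of changes in the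
   word of the splits, once it is framed by two B's.  Then
   2 (2a - j) + j'^2 <= j^2 + 1, so that 2t + j^2 <= k for all powers t after k
   strands, whence t <= n/2 in the end.  Using an A-split whenever there is a
   crossing makes j alternate between 0 and 1 and reaches floor(n/2).  Dually
   j <= k, so that t >= - n (n - 1) / 2, with equality for B-splits only. *)
Require Import Defs.
From mathcomp Require Import all_boot all_order all_fingroup all_algebra.
From mathcomp Require Import finmap zify.
From mathcomp.multinomials Require Import monalg.

Set Implicit Arguments.
Unset Strict Implicit.
Unset Printing Implicit Defensive.

Import Order.TTheory GRing.Theory Num.Theory.

(** * Words of splits: mixed arcs against A-splits *)

Lemma state_powerE (w : seq bool) :
  state_power w = (Posz (count id w) *+ 2 - Posz (size w))%R.
Proof.
rewrite /state_power; elim: w => [|[] w IH]; rewrite ?big_nil ?big_cons //= IH; lia.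
Qed.

(* The number of arcs joining a left point to a right one among those that the
   resolution w produces, the arc being followed starting on the right when b
   holds. *)
Fixpoint new_mixed (b : bool) (w : seq bool) : nat :=
  if w is a :: w' then ((a == b) + new_mixed a w')%N else ~~ b.

Lemma new_mixed_le (b : bool) (w : seq bool) : (new_mixed b w <= size w + ~~ b)%N.
Proof. by elim: w b => [|[] w IH] [] //=; have := IH true; have := IH false; lia. Qed.

(** An A-split in a word framed by two B's forces at least two changes of letter, each costing one
    mixed arc. *)
Lemma new_mixed_has (w : seq bool) : has id w -> (new_mixed false w < size w)%N.
Proof.
elim: w => [|[] w IH] //=; first by have := new_mixed_le true w; lia.
Qed.

(** Distinct runs of A-splits are separated by B-splits: a word with few B-splits changes letter
    rarely, which keeps [new_mixed] large. *)
Lemma count_new_mixed (b : bool) (w : seq bool) :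
  (2 * count id w <= size w + new_mixed b w + ~~ b)%N.
Proof. by elim: w b => [|[] w IH] [] //=; have := IH true; have := IH false; lia. Qed.

Lemma new_mixed_nhas (w : seq bool) :
  ~~ has id w -> new_mixed false w = (size w).+1 /\ count id w = 0%N.
Proof. by elim: w => [|[] w IH] //= /IH; lia. Qed.

(** The potential 2t + j^2 grows by at most 1 per strand, here written without subtraction; B-splits
    alone give equality. *)
Lemma potential_step (w : seq bool) :
  (4 * count id w + new_mixed false w ^ 2 <= size w ^ 2 + 2 * size w + 1)%N.
Proof.
have [hw|/new_mixed_nhas[-> ->]] := boolP (has id w); last by nia.
(* With j = [size w], j' = [new_mixed false w] and a A-splits, 4a + j'^2 <= 2j + 1 + (j' + 1)^2, and
   j' + 1 <= j. *)
have := new_mixed_has hw; have /= := count_new_mixed false w; nia.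
Qed.

(** * Arcs between tails and tips *)

Section Splits.
Variable n : nat.
Notation point := 'I_(n + n).
Notation split := {set {set point}}.
Implicit Types (S : split) (d : 'I_n) (e p q stop : point) (cs : seq (point * point)).

(** The endpoints of the strands d, ..., n - 1; a natural number d allows d = n, with no strand
    left. *)
Definition used (d : nat) p := (d <= p < n)%N || (n + d <= p)%N.

Definition confined (d : nat) S := forall a, a \in S -> forall p, p \in a -> used d p.

(* The arcs joining a tail to a tip.  If S involves only the strands d + 1, ...,
   n - 1, these are the arcs crossed by strand d. *)
Definition mixed S : {set point * point} :=
  [set c : point * point | (c.1 < n <= c.2)%N && ([set c.1; c.2] \in S)].

Lemma set2_mixed_inj (c : point * point) e q :
  (c.1 < n <= c.2)%N -> [set c.1; c.2] = [set e; q] ->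
  c = (e, q) /\ (e < n <= q)%N \/ c = (q, e) /\ (q < n <= e)%N.
Proof.
case: c => l r /= h E.
have: l \in [set e; q] by rewrite -E set21.
have: r \in [set e; q] by rewrite -E set22.
rewrite !inE => /orP[/eqP ?|/eqP ?] /orP[/eqP ?|/eqP ?]; subst; try lia; by auto.
Qed.

(** Only an upper bound, as the arc may already lie in [S]. Such bounds suffice without tracking
    disjointness of arcs; lower bounds come from explicit arcs. *)
Lemma mixed_setU1 e q S :
  (#|mixed ([set e; q] |: S)| <= ((e < n)%N != (q < n)%N) + #|mixed S|)%N.
Proof.
pose c0 := if (e < n)%N then (e, q) else (q, e).
have sub : mixed ([set e; q] |: S) \subset
    (if (e < n)%N != (q < n)%N then [set c0] else set0) :|: mixed S.
  apply/subsetP => c; rewrite !inE => /andP[h /orP[/eqP /(set2_mixed_inj h)|->]];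
    last by rewrite h orbT.
  rewrite /c0 => -[[-> /andP[he hq]]|[-> /andP[hq he]]].
    by rewrite he ltnNge hq /= inE eqxx.
  by rewrite hq ltnNge he /= inE eqxx.
apply: leq_trans (subset_leq_card sub) _; apply: leq_trans (leq_card_setU _ _) _.
by rewrite leq_add2r; case: ifP; rewrite ?cards1 ?cards0.
Qed.

Lemma mixed_set0 : mixed set0 = set0.
Proof. by apply/setP => c; rewrite !inE andbF. Qed.

(** After an A-split the next arc starts at a tip [r], after a B-split at a tail [l], so the flag of
    [new_mixed] is the previous split. *)
Lemma resolved_arcs_mixed e stop cs w :
  size w = size cs -> all (fun c : point * point => c.1 < n <= c.2)%N cs -> (n <= stop)%N ->
  (#|mixed (resolved_arcs e stop cs w)| <= new_mixed (n <= e)%N w)%N.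
Proof.
move=> + + hstop; elim: cs w e => [|[l r] cs IH] [|a w] e //=.
  move=> _ _; have := mixed_setU1 e stop set0.
  by rewrite setU0 mixed_set0 cards0 !ltnNge hstop; case: (n <= e)%N.
move=> [hw] /andP[hlr hcs].
case: a; apply: leq_trans (mixed_setU1 _ _ _) _; apply: leq_add.
- by rewrite !ltnNge; lia.
- by have [_ hr] := andP hlr; have := IH w r hw hcs; rewrite hr.
- by rewrite !ltnNge; lia.
- by have [hl _] := andP hlr; have := IH w l hw hcs; rewrite [(n <= l)%N]leqNgt hl.
Qed.

Lemma resolved_arcs_all (P : pred point) e stop cs w :
  P e -> P stop -> all (fun c : point * point => P c.1 && P c.2) cs ->
  forall a, a \in resolved_arcs e stop cs w -> forall p, p \in a -> P p.
Proof.
move=> + hstop; elim: cs w e => [|[l r] cs IH] w e he /= hcs.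
  by move=> a; rewrite inE => /eqP-> p; rewrite !inE => /orP[] /eqP->.
move: hcs => /andP[/andP[hl hr] hcs] a.
case: w => [|[] w]; rewrite !inE.
- by move=> /eqP-> p; rewrite !inE => /orP[] /eqP->.
- case/orP=> [/eqP-> p|]; last exact: IH.
  by rewrite !inE => /orP[] /eqP->.
- case/orP=> [/eqP-> p|]; last exact: IH.
  by rewrite !inE => /orP[] /eqP->.
Qed.

(** Successive B-splits shift the right ends by one: [e] gets the first, each left end the next one,
    and the last left end gets [stop]. *)
Lemma resolved_arcs_nseqB e stop cs l :
  (n <= stop)%N -> all (fun c : point * point => n <= c.2)%N cs -> l \in e :: unzip1 cs ->
  exists2 r : point, (n <= r)%N &
    [set l; r] \in resolved_arcs e stop cs (nseq (size cs) false).
Proof.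
move=> hstop; elim: cs e => [|[l1 r1] cs IH] e /=.
  by rewrite inE => _ /eqP->; exists stop; rewrite // inE.
move=> /andP[hr hcs]; rewrite inE => /orP[/eqP->|/(IH _ hcs)[r hr' hS]].
  by exists r1; rewrite // !inE eqxx.
by exists r; rewrite // inE hS orbT.
Qed.

(** * Arcs met by an overstrand *)

Lemma mem_crossed S d (c : point * point) :
  (c \in crossed S d) = [&& (d < c.1 < n + d)%N, (c.2 < d)%N || (n + d < c.2)%N &
                           [set c.1; c.2] \in S].
Proof.
have ->: [&& (d < c.1 < n + d)%N, (c.2 < d)%N || (n + d < c.2)%N & [set c.1; c.2] \in S]
    = ([set c.1; c.2] \in S) && ((c.1 \in left_points d) && (c.2 \in right_points d)).
  by rewrite [c.1 \in _]mem_filter [c.2 \in _]mem_filter !mem_enum !inE !andbT [RHS]andbC !andbA.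
rewrite mem_filter; congr andb; case: c => l r; apply/allpairsP/andP => [[[? ?] [/= hl hr [-> ->]]]|[hl hr]] //.
by exists (l, r).
Qed.

Lemma crossed_uniq S d : uniq (crossed S d).
Proof.
have hu : uniq (enum point) := enum_uniq _.
apply/filter_uniq/allpairs_uniq; try exact: filter_uniq.
by move=> [? ?] [].
Qed.

(** The order of the strands enters here: the tails of the strands after [d] all lie on its left,
    their tips on its right. *)
Lemma mem_crossed_mixed S d : confined d.+1 S -> crossed S d =i mixed S.
Proof.
move=> hS c; rewrite mem_crossed inE.
have [/hS hc|] := boolP ([set c.1; c.2] \in S); last by rewrite !andbF.
have := hc c.1 (set21 _ _); have := hc c.2 (set22 _ _).
rewrite /used; rewrite !andbT; case: c {hc} => l r /=; have := ltn_ord d; lia.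
Qed.

Definition crossing_number S : nat := #|mixed S|.

Lemma crossing_number0 : crossing_number set0 = 0%N.
Proof. by rewrite /crossing_number mixed_set0 cards0. Qed.

Lemma size_crossed S d : confined d.+1 S -> size (crossed S d) = crossing_number S.
Proof.
by move=> hS; rewrite -(card_uniqP (crossed_uniq S d)) (eq_card (mem_crossed_mixed hS)).
Qed.

Lemma resolve_confined S d w : confined d.+1 S -> confined d (resolve S d w).
Proof.
move=> hS a; rewrite !inE => /orP[/andP[_ /hS ha] p /ha|].
  by rewrite /used; lia.
apply: resolved_arcs_all; rewrite ?/used /=; have := ltn_ord d; try lia.
move=> _; apply/allP => c; rewrite mem_crossed => /and3P[_ _ /hS hc].
have := hc c.1 (set21 _ _); have := hc c.2 (set22 _ _).
rewrite /used; case: c {hc} => l r /=; lia.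
Qed.

Lemma crossed_all_mixed S d :
  confined d.+1 S -> all (fun c : point * point => c.1 < n <= c.2)%N (crossed S d).
Proof.
by move=> hS; apply/allP => c; rewrite (mem_crossed_mixed hS) inE => /andP[].
Qed.

(** Every mixed arc of [S] is crossed by [d], hence removed; those of the result all come from the
    resolution. *)
Lemma resolve_mixed S d w : confined d.+1 S -> size w = size (crossed S d) ->
  (crossing_number (resolve S d w) <= new_mixed false w)%N.
Proof.
move=> hS hw.
have hd : (n <= tail d)%N = false by rewrite leqNgt /= ltn_ord.
have := @resolved_arcs_mixed (tail d) (tip d) _ _ hw (crossed_all_mixed hS) (leq_addr _ _).
rewrite hd; apply: leq_trans; apply/subset_leq_card/subsetP => c.
rewrite !inE => /andP[h /orP[/andP[/negP hN hc]|->]]; last by rewrite h.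
by case: hN; apply/imset_f; rewrite (mem_crossed_mixed hS) inE h.
Qed.

(** * Terms of the relation and absence of cancellation *)

Implicit Type R : relation n.

Definition term := (split * int)%type.
Implicit Type T : term.

Lemma mcoeff_lay_over d R T :
  ((lay_over d R)@_T = \sum_(T' <- msupp R)
    \sum_(w : (size (crossed T'.1 d)).-tuple bool)
      R@_T' *+ ((resolve T'.1 d w, T'.2 + state_power w) == T))%R.
Proof.
rewrite raddf_sum; apply: eq_bigr => T' _; rewrite raddf_sum.
by apply: eq_bigr => w _; rewrite /= mcoeffU.
Qed.

Lemma lay_over_ge0 d R :
  (forall T, 0 <= R@_T)%R -> forall T, (0 <= (lay_over d R)@_T)%R.
Proof.
move=> hR T; rewrite mcoeff_lay_over.
by apply: sumr_ge0 => T' _; apply: sumr_ge0 => w _; exact: mulrn_wge0 (hR _).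
Qed.

(** Nonnegative contributions cannot cancel, so every choice of splits on every term survives in the
    support. *)
Lemma lay_overP d R T : (forall T, 0 <= R@_T)%R ->
  reflect (exists2 T', T' \in msupp R & exists2 w : seq bool, size w = size (crossed T'.1 d) &
             T = (resolve T'.1 d w, T'.2 + state_power w)%R)
          (T \in msupp (lay_over d R)).
Proof.
move=> hR; rewrite -mcoeff_neq0 mcoeff_lay_over psumr_neq0; last first.
  by move=> T' _; apply: sumr_ge0 => w _; exact: mulrn_wge0 (hR _).
apply: (iffP hasP) => -[T' hT'].
  rewrite /= lt0r => /andP[+ _]; rewrite psumr_neq0; last by move=> w _; exact: mulrn_wge0 (hR _).
  case/hasP=> w _ /=; case: eqP => [<- _|]; last by rewrite mulr0n ltxx.
  by exists T' => //; exists w; rewrite ?size_tuple.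
case=> w hw ->; exists T' => //=.
rewrite (bigD1 (Tuple (introT eqP hw))) //= eqxx; apply: ltr_wpDr.
  by apply: sumr_ge0 => w' _; exact: mulrn_wge0 (hR _).
by rewrite mulr1n lt0r hR mcoeff_neq0 hT'.
Qed.

(* The relation of the 0-crossing, as opposed to [skein [::]], which is 0. *)
Definition base_relation : relation n := << 1 *g (set0, 0%R) >>%R.

Lemma lay_over_base d :
  lay_over d base_relation = << 1 *g ([set [set tail d; tip d]], 0%R) >>%R.
Proof.
rewrite /lay_over /base_relation msuppU oner_eq0 big_seq_fset1 /= mcoeffU eqxx.
have h0 : crossed (set0 : split) d = [::].
  by apply/nilP; rewrite /nilp size_crossed ?crossing_number0 // => a; rewrite inE.
have hr : resolve set0 d [::] = [set [set tail d; tip d]] by rewrite /resolve h0 set0D set0U.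
rewrite (eq_bigr (fun=> << 1 *g ([set [set tail d; tip d]], 0%R) >>%R)); last first.
  case=> w /= hw _.
  have {hw} -> : w = [::] by apply/nilP; rewrite /nilp; rewrite h0 in hw.
  by rewrite /state_power big_nil addr0 hr.
by rewrite sumr_const card_tuple h0 /= expn0 mulr1n.
Qed.

Lemma skein_foldr (s : seq 'I_n) : s != [::] ->
  skein s = foldr (@lay_over n) base_relation s.
Proof.
elim: s => [|d [|d' s] IH] hs; first by case/eqP: hs.
  exact: esym (lay_over_base d).
exact: (congr1 (lay_over d) (IH isT)).
Qed.

Lemma foldr_lay_over_ge0 (s : seq 'I_n) T :
  (0 <= (foldr (@lay_over n) base_relation s)@_T)%R.
Proof.
elim: s T => [|d s IH] T; last exact: lay_over_ge0.
by rewrite /= mcoeffU; apply: mulrn_wge0.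
Qed.

(** * Bounds on the powers and terms attaining them *)

Lemma map_val_cons_iota d (s : seq 'I_n) (m : nat) :
  map val (d :: s) = iota m (size s).+1 -> val d = m /\ map val s = iota m.+1 (size s).
Proof. by case. Qed.

(** The third bound accumulates [potential_step]. The last one adds up losses of at most 0, 1, ...,
    [size s] - 1, since an overstrand meets at most as many arcs as there are strands below it.
    Powers are doubled to avoid halves. *)
Lemma term_bounds (s : seq 'I_n) (m : nat) T :
  map val s = iota m (size s) -> T \in msupp (foldr (@lay_over n) base_relation s) ->
  [/\ confined m T.1, (crossing_number T.1 <= size s)%N,
      (T.2 *+ 2 + Posz (crossing_number T.1 ^ 2) <= Posz (size s))%R
    & (- Posz (size s * (size s).-1) <= T.2 *+ 2)%R].
Proof.
elim: s m T => [|d s IH] m T.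
  rewrite /= msuppU oner_eq0 inE => _ /eqP->.
  by rewrite /= crossing_number0; split => // a; rewrite inE.
move=> /map_val_cons_iota[<- hs] /lay_overP[]; first exact: foldr_lay_over_ge0.
move=> [S t] /(IH _ _ hs)/=[hc hsz hup hlo] [w hw ->]; rewrite /= state_powerE.
have hN := resolve_mixed hc hw; have /= hN1 := new_mixed_le false w.
have hpot := potential_step w.
rewrite size_crossed // in hw.
split; first exact: resolve_confined.
- by apply: leq_trans hN (leq_trans hN1 _); rewrite hw addn1.
- have : (crossing_number (resolve S d w) ^ 2 <= new_mixed false w ^ 2)%N by rewrite leq_exp2r.
  move: hup hpot; rewrite hw.
  move: (_ ^ 2)%N (_ ^ 2)%N (_ ^ 2)%N => x y z; lia.
- have : (size s * (size s).-1 + 2 * size s = (size s).+1 * size s)%N by case: (size s) => // k /=; nia.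
  rewrite hw; move: (_ * _.-1)%N ((size s).+1 * _)%N hlo => x y; lia.
Qed.

(* Only B-splits: the overstrand then always meets all the previous strands, as
   every tail stays joined to a tip. *)
Lemma lowest_term (s : seq 'I_n) (m : nat) : map val s = iota m (size s) ->
  exists2 T, T \in msupp (foldr (@lay_over n) base_relation s) &
    (T.2 *+ 2 <= - Posz (size s * (size s).-1))%R /\
    forall d, d \in s -> exists2 r : point, (n <= r)%N & [set tail d; r] \in T.1.
Proof.
elim: s m => [|d s IH] m; first by exists (set0, 0%R); rewrite //= msuppU oner_eq0 inE.
move=> /map_val_cons_iota[<- hs]; have [[S t] hT /= [hlo htails]] := IH _ hs.
have /= [hc _ _ _] := term_bounds hs hT.
pose w := nseq (size (crossed S d)) false.
exists (resolve S d w, t + state_power w)%R.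
  apply/lay_overP; first exact: foldr_lay_over_ge0.
  by exists (S, t) => //; exists w; rewrite // size_nseq.
split => /=.
  have hge : (size s <= crossing_number S)%N.
    have us : uniq s by rewrite -(map_inj_uniq val_inj) hs iota_uniq.
    (* The tails of [s] are distinct, and each is the first component of a mixed pair. *)
    rewrite -(card_uniqP us) -(card_imset _ (@lshift_inj n n)).
    apply: leq_trans (leq_imset_card fst (mixed S)); apply/subset_leq_card/subsetP => p.
    case/imsetP => l /htails[r hr hlr] ->; apply/imsetP; exists (tail l, r) => //.
    by rewrite inE /= ltn_ord hr.
  rewrite state_powerE /w count_nseq size_nseq size_crossed //= mul0n.
  have : (size s * (size s).-1 + 2 * size s = (size s).+1 * size s)%N by case: (size s) => // k /=; nia.
  move: (_ * _.-1)%N ((size s).+1 * _)%N hlo hge => x y; lia.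
move=> l hl.
have [] := @resolved_arcs_nseqB (tail d) (tip d) (crossed S d) (tail l).
- exact: leq_addr.
- by apply/sub_all/(crossed_all_mixed hc) => c /andP[].
- move: hl; rewrite !inE => /orP[/eqP->|/htails[r hr hlr]]; first by rewrite eqxx.
  apply/orP; right; apply/mapP; exists (tail l, r) => //.
  by rewrite (mem_crossed_mixed hc) inE /= ltn_ord hr.
- by move=> r hr hlr; exists r; rewrite // inE hlr orbT.
Qed.

(* An A-split whenever there is a crossing: the number of crossings met by the
   overstrand then alternates between 0 and 1. *)
Lemma highest_term (s : seq 'I_n) (m : nat) : map val s = iota m (size s) ->
  exists2 T, T \in msupp (foldr (@lay_over n) base_relation s) &
    (crossing_number T.1 <= 1)%N /\ (Posz (size s) <= T.2 *+ 2 + Posz (crossing_number T.1))%R.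
Proof.
elim: s m => [|d s IH] m.
  by exists (set0, 0%R); rewrite ?crossing_number0 //= msuppU oner_eq0 inE.
move=> /map_val_cons_iota[<- hs]; have [[S t] hT /= [h1 hhi]] := IH _ hs.
have /= [hc _ _ _] := term_bounds hs hT.
pose w := nseq (size (crossed S d)) true.
exists (resolve S d w, t + state_power w)%R.
  apply/lay_overP; first exact: foldr_lay_over_ge0.
  by exists (S, t) => //; exists w; rewrite // size_nseq.
have hw : size w = size (crossed S d) by rewrite size_nseq.
have := resolve_mixed hc hw; have hsz := size_crossed hc.
rewrite state_powerE /w count_nseq size_nseq hsz.
(* With one crossing, the A-split adds 2 to 2t and leaves no mixed arc; with none, t is unchanged
   and strand [d] itself becomes a mixed arc. *)
case: (crossing_number S) h1 hsz hhi => [|[|k]] //= _ hsz hhi hle; split; try lia.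
have : (0 < crossing_number (resolve S d [::]))%N; last by lia.
apply/card_gt0P; exists (tail d, tip d).
by rewrite !inE /= ltn_ord leq_addr /= (size0nil hsz) inE eqxx orbT.
Qed.

(** * Highest and lowest powers from attained bounds *)

Lemma max_powerE R T :
  T \in msupp R -> (forall T', T' \in msupp R -> T'.2 <= T.2)%R -> max_power R = T.2.
Proof.
move=> hT hmax; apply/eqP; rewrite eq_le; apply/andP; split; last first.
  by apply: (@le_bigmax_seq _ _ _ _ _ T.2 xpredT id); rewrite // map_f.
have hp t : t \in powers R -> (t <= T.2)%R by case/mapP => T' /hmax h ->.
rewrite /max_power big_seq; apply: (big_ind (fun x => (x <= T.2)%R)) => //.
- have : T.2 \in powers R by rewrite map_f.
  by case: (powers R) hp => // t r hp _; apply: hp; rewrite inE eqxx.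
- by move=> x y hx hy; rewrite ge_max hx.
Qed.

Lemma min_powerE R T :
  T \in msupp R -> (forall T', T' \in msupp R -> T.2 <= T'.2)%R -> min_power R = T.2.
Proof.
move=> hT hmin; apply/eqP; rewrite eq_le; apply/andP; split.
  by apply: (@ge_bigmin_seq _ _ _ _ _ T.2 xpredT id); rewrite // map_f.
have hp t : t \in powers R -> (T.2 <= t)%R by case/mapP => T' /hmin h ->.
rewrite /min_power big_seq; apply: (big_ind (fun x => (T.2 <= x)%R)) => //.
- have : T.2 \in powers R by rewrite map_f.
  by case: (powers R) hp => // t r hp _; apply: hp; rewrite inE eqxx.
- by move=> x y hx hy; rewrite le_min hx.
Qed.

End Splits.

Theorem corollary2p8 (n : nat) (hn : (2 <= n)%N) :
  width (skein_12n n) = Posz ((n ^ 2) %/ 2)%N.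
Proof.
have hs : map val (enum 'I_n) = iota 0 (size (enum 'I_n)) by rewrite val_enum_ord size_enum_ord.
have -> : skein_12n n = foldr (@lay_over n) (base_relation n) (enum 'I_n).
  rewrite /skein_12n /skein_relation (eq_map (g := id)) ?map_id; last by move=> k; rewrite perm1.
  by rewrite skein_foldr // -size_eq0 size_enum_ord -lt0n ltnW.
have [[Sl tl] hl /= [hlo _]] := lowest_term hs.
have [[Sh th] hh /= [h1 hhi]] := highest_term hs.
have hb S t : (S, t) \in msupp (foldr (@lay_over n) (base_relation n) (enum 'I_n)) ->
    (t *+ 2 + Posz (crossing_number S ^ 2) <= Posz n)%R /\
    (- Posz (n * n.-1) <= t *+ 2)%R.
  by move=> /(term_bounds hs)/= [_ _]; rewrite size_enum_ord.
rewrite size_enum_ord in hlo hhi.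
have hb2 S t h := (hb S t h).2.
have {}hb S t : (S, t) \in msupp (foldr (@lay_over n) (base_relation n) (enum 'I_n)) ->
    (t *+ 2 <= Posz n)%R by move=> /hb[]; move: (_ ^ 2)%N => x; lia.
(* From 2t <= n <= 2 [th] + 1, integrality gives t <= [th]. *)
rewrite /width (max_powerE hh) => [|[S t] /hb /=]; last by lia.
rewrite (min_powerE hl) => [|[S t] /hb2 /=]; last first.
  by move: (_ * _)%N hlo => x; lia.
(* As n(n - 1) = -2 [tl] is even, halving n^2 = n(n - 1) + n yields -[tl] plus the floor of n/2,
   which is [th]. *)
have hsq k : (k ^ 2 = k * k.-1 + k)%N by case: k => // k; nia.
rewrite /= hsq; have := hb2 _ _ hl; have := hb _ _ hh.
by move: (_ * _)%N hlo => x; lia.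
Qed.
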